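(* Let $X$ be $\mathbb{R}^d$ ($d\ge 1$ an integer) with Lebesgue measure $\mu$, or $\mathbb{Z}$ with counting measure $\nu$. For $f\in L^1(X)$ with centered frequency function $r_x$ and for each positive integer $N$, define $$Z_{N,f}:=\{x\in X: |x|\le N,\ r_x=0\}.$$ Let $g:\mathbb{N}\to(0,\infty)$ be a non-decreasing function such that $g(N)\to\infty$ as $N\to\infty$. Then: (i) There exists $0\neq f\in L^1(\mathbb{R}^d)$ such that $$\limsup_{N\to\infty}\frac{\mu(Z_{N,f})}{N^d/g(N)}\ge\frac{C_d}{2^d},$$ where $C_d:=\mu(B_1(0))$ is the volume of the unit ball in $\mathbb{R}^d$. (ii) There exists $0\neq f\in\ell^1(\mathbb{Z})$ such that $$\limsup_{N\to\infty}\frac{\nu(Z_{N,f})}{N/g(N)}\ge1.$$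
   Context: $N$ ranges over the positive integers; $\mathbb{N}$ denotes the non-negative integers. Here $f\ne0$ means $f$ is not the zero element of $L^1$, and the limsup may be $+\infty$. Continuous: for $f\in L^1(\mathbb{R}^d)$ put $A_r|f|(x)=\frac{1}{\mu(B_r(x))}\int_{B_r(x)}|f(y)|\,dy$ ($B_r(x)$ the open Euclidean ball) and $Mf(x)=\sup_{r>0}A_r|f|(x)$. Let $E_{f,x}=\{r>0: Mf(x)=A_r|f|(x)\}$; then $r_x=\inf E_{f,x}$ if $E_{f,x}\neq\emptyset$, and $r_x=0$ otherwise. The function $x\mapsto r_x$ is Lebesgue measurable. Discrete: for $f\in\ell^1(\mathbb{Z})=L^1(\mathbb{Z})$ and $r\in\mathbb{N}$, put $A_r|f|(n)=\frac{1}{2r+1}\sum_{j=-r}^{r}|f(n+j)|$ and $Mf(n)=\sup_{r\in\mathbb{N}}A_r|f|(n)$. The supremum is attained, and $r_n=\min\{r\in\mathbb{N}: Mf(n)=A_r|f|(n)\}$. *)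

(* Defs.v *)
From HB Require Import structures.
From mathcomp Require Import all_boot all_order all_algebra.
From mathcomp Require Import all_classical all_reals all_analysis.

Set Implicit Arguments.
Unset Strict Implicit.
Unset Printing Implicit Defensive.

Import Order.TTheory GRing.Theory Num.Theory.
Import numFieldNormedType.Exports.

Local Open Scope classical_set_scope.
Local Open Scope ring_scope.

(* R^d, as d-tuples with the product Borel sigma-algebra that the library
   puts on tuples. *)
Notation euclidean R d := (d.-tuple (measurableTypeR R)) (only parsing).

Section lebesgue_tuple_step.
Context (R : realType) (d : nat).
Variable mu : {sigma_finite_measure set (euclidean R d) -> \bar R}.

Definition tuple_cons (p : measurableTypeR R * euclidean R d) :
  euclidean R d.+1 := [tuple of p.1 :: p.2].

Lemma measurable_tuple_cons : measurable_fun [set: _] tuple_cons.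
Proof. exact: measurable_cons. Qed.

Definition lebesgue_step : set (euclidean R d.+1) -> \bar R :=
  pushforward (@lebesgue_measure R \x mu)%E tuple_cons.

Let m : {measure set (euclidean R d.+1) -> \bar R} :=
  measure_function_pushforward__canonical__measure_function_Measure
   (@lebesgue_measure R \x mu)%E measurable_tuple_cons.

Let step0 : lebesgue_step set0 = 0%E. Proof. exact: (measure0 m). Qed.
Let step_ge0 A : (0 <= lebesgue_step A)%E. Proof. exact: (measure_ge0 m). Qed.
Let step_additive : semi_sigma_additive lebesgue_step.
Proof. exact: (@measure_semi_sigma_additive _ _ _ m). Qed.

HB.instance Definition _ :=
  isMeasure.Build _ _ _ lebesgue_step step0 step_ge0 step_additive.

Lemma lebesgue_stepX (A : set (measurableTypeR R)) (B : set (euclidean R d)) :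
  measurable A -> measurable B ->
  lebesgue_step [set x | A (thead x) /\ B [tuple of behead x]] =
  (lebesgue_measure A * mu B)%E.
Proof.
move=> mA mB; rewrite -product_measure1E//= /lebesgue_step /pushforward.
congr product_measure1; apply/seteqP; split => -[x y];
  by rewrite /= theadE (_ : [tuple of _] = y)//; exact/val_inj.
Qed.

Let step_sigma_finite : sigma_finite [set: _] lebesgue_step.
Proof.
have /sigma_finiteP[F [TF ndF Foo]] := sigma_finiteT (@lebesgue_measure R).
have /sigma_finiteP[G [TG ndG Goo]] := sigma_finiteT mu.
exists (fun n => [set x | F n (thead x) /\ G n [tuple of behead x]]).
  apply/esym/seteqP; split => // x _.
  have : [set: measurableTypeR R] (thead x) by [].
  have : [set: euclidean R d] [tuple of behead x] by [].
  rewrite TF TG => -[n _ Gn] [k _ Fk]; exists (maxn n k) => //=; split.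
    by move: Fk; exact/subsetPset/ndF/leq_maxr.
  by move: Gn; exact/subsetPset/ndG/leq_maxl.
move=> n; have [mF Fn] := Foo n; have [mG Gn] := Goo n; split.
  have := @measurable_tnth _ _ d.+1 ord0 measurableT _ mF.
  have := measurable_behead measurableT mG.
  by rewrite !setTI => mGn mFn; exact: measurableI _ _ mFn mGn.
by rewrite lebesgue_stepX// lte_mul_pinfty// ge0_fin_numE.
Qed.

HB.instance Definition _ := Measure_isSigmaFinite.Build _ _ _
  lebesgue_step step_sigma_finite.

End lebesgue_tuple_step.

(* Lebesgue measure on R^d, as an iterated product of Lebesgue measure on R,
   carried over to tuples by (t, (x_1, .., x_d)) |-> (t, x_1, .., x_d).  See
   lebesgue_tuple_box for the measure of boxes. *)
Fixpoint lebesgue_tuple (R : realType) (d : nat) :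
    {sigma_finite_measure set (euclidean R d) -> \bar R} :=
  if d is d'.+1 then lebesgue_step (lebesgue_tuple R d') else \d_[tuple].

Lemma lebesgue_tuple_box (R : realType) (d : nat)
    (A : 'I_d -> set (measurableTypeR R)) : (forall i, measurable (A i)) ->
  lebesgue_tuple R d [set x | forall i, A i (tnth x i)] =
  (\prod_(i < d) lebesgue_measure (A i))%E.
Proof.
elim: d A => [|d IH] A mA.
  by rewrite big_ord0 /= diracE mem_set// => -[].
pose B := [set x : euclidean R d | forall i, A (lift ord0 i) (tnth x i)].
have mB : measurable B.
  rewrite (_ : B = \big[setI/setT]_(i < d)
      ((fun x : euclidean R d => tnth x i) @^-1` A (lift ord0 i))).
    apply: bigsetI_measurable => i _; rewrite -[X in measurable X]setTI.
    exact: measurable_tnth.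
  rewrite -classical_sets.bigcap_seq; apply/seteqP; split => x Bx /= i.
    by move=> _; exact: Bx.
  by apply: Bx; rewrite /= mem_index_enum.
rewrite big_ord_recl -IH// -(lebesgue_stepX (lebesgue_tuple R d) (mA ord0) mB).
congr (lebesgue_step _ _); apply/seteqP; split => x;
  case/tupleP: x => t x /=; rewrite theadE (_ : [tuple of _] = x);
  do ?exact/val_inj.
  move=> Ax; split=> [|i]; first exact: (Ax ord0).
  by have := Ax (lift ord0 i); rewrite tnthS.
by move=> [A0 AS] i; have [j ->|->//] := unliftP ord0 i; rewrite tnthS; exact: AS.
Qed.

Section continuous_frequency.
Context (R : realType) (d : nat).
Implicit Types (x y : euclidean R d) (r : R) (f : euclidean R d -> R).

Local Notation mu := (lebesgue_tuple R d).

Definition eorigin : euclidean R d := [tuple of nseq d (0 : R)].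

Definition edist x y : R :=
  Num.sqrt (\sum_(i < d) ((tnth x i : R) - (tnth y i : R)) ^+ 2).

Definition enorm x : R := edist x eorigin.

Definition eball x r : set (euclidean R d) := [set y | edist x y < r].

Definition ball_avg f r x : \bar R :=
  ((mu (eball x r))^-1 * \int[mu]_(y in eball x r) `|(f y)%:E|)%E.

Definition maximal f x : \bar R :=
  ereal_sup [set ball_avg f r x | r in [set r | 0 < r]].

Definition attaining_radii f x : set R :=
  [set r | 0 < r /\ maximal f x = ball_avg f r x].

Definition frequency f x : R :=
  if attaining_radii f x == set0 then 0 else inf (attaining_radii f x).

(* ball_avg f r x is jointly continuous in (r, x) for r > 0 and integrable f, so
   this set is Borel and its Borel measure is its Lebesgue measure. *)
Definition Zset f (N : nat) : set (euclidean R d) :=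
  [set x | enorm x <= N%:R /\ frequency f x = 0].

End continuous_frequency.

Section discrete_frequency.
Context (R : realType).
Implicit Types (f : int -> R) (n : int) (r : nat).

Definition int_avg f r n : R :=
  (\sum_(k < (2 * r).+1) `|f (n + (k%:Z - r%:Z))|) / ((2 * r).+1)%N%:R.

Definition int_maximal f n : \bar R :=
  ereal_sup (range (fun r => (int_avg f r n)%:E)).

Definition int_attaining_radii f n : set nat :=
  [set r | int_maximal f n = (int_avg f r n)%:E].

(* The least attaining radius.  There is one whenever f is summable, so that the
   default value 0 of xget is then irrelevant. *)
Definition int_frequency f n : nat :=
  xget 0%N [set r | int_attaining_radii f n r /\
    forall s, int_attaining_radii f n s -> (r <= s)%N].

Definition int_Zset f (N : nat) : set int :=
  [set n | `|n| <= N%:Z /\ int_frequency f n = 0%N].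

End discrete_frequency.

(* Main.v *)
(** Let N_k grow so fast that N_(k+1) >= 4 N_k and g(N_k) >= K 2^k for a constant
    K = K(d), and let f be equal to c_k = K / N_k^d on a box S_k of measure
    N_k^d / g(N_k) lying at distance comparable to N_k from the origin, inside the
    ball of radius N_k, and to 0 off these boxes.  The total mass of f is at
    most 1.  For x in S_k, a ball around x of radius less than a small multiple
    of N_k meets no earlier box, and the c_j decrease, so f <= c_k on it; a larger
    ball has measure at least 1 / c_k, and total mass 1 bounds the average by c_k
    again.  Hence the maximal function at x is c_k = f(x), attained by all small
    radii, and S_k is contained in Z_(N_k).  This gives a limsup of at least 1,
    and the volume of the unit ball is at most 2^d.  On the integers, blocks of
    consecutive points play the role of the boxes. *)

Require Import Defs.
From HB Require Import structures.
From mathcomp Require Import all_boot all_order all_algebra.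
From mathcomp Require Import all_classical all_reals all_analysis.
From mathcomp Require Import measurable_realfun.
From mathcomp Require Import zify lra ring.

Set Implicit Arguments.
Unset Strict Implicit.
Unset Printing Implicit Defensive.

Import Order.TTheory GRing.Theory Num.Theory.
Import numFieldNormedType.Exports.

Local Open Scope classical_set_scope.
Local Open Scope ring_scope.

(** * Limsups along a subsequence, and lacunary sequences of scales *)

Lemma limn_esup_ge (R : realType) (u : nat -> \bar R) (a : \bar R)
    (N : nat -> nat) :
  (forall k, (k <= N k)%N) -> (forall k, (a <= u (N k))%E) ->
  (a <= limn_esup u)%E.
Proof.
move=> kN aN; apply: le_ereal_inf_tmp => _ [V [n _ nV] <-].
(* The tail starting at [n] contains the index [N n], because [n <= N n]. *)
apply: le_trans (aN n) _; apply: ereal_sup_ubound.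
by exists (N n) => //; apply: nV; rewrite /= kN.
Qed.

(** Since [g] diverges, each term can be chosen beyond both four times its predecessor and the point
    after which [g] exceeds [b k]. The factor 4 later keeps half-size neighbourhoods of one block
    away from all earlier blocks. *)
Lemma exists_lacunary (R : realType) (g : nat -> R) (b : nat -> R) :
  g N @[N --> \oo] --> +oo ->
  exists N : nat -> nat, [/\ forall k, (0 < N k)%N,
    forall k, (4 * N k <= N k.+1)%N & forall k, b k <= g (N k)].
Proof.
move=> /cvgryPge goo.
have next k m : {n : nat | [/\ (0 < n)%N, (4 * m <= n)%N & b k <= g n]}.
  apply: cid; have [n0 _ ng] := goo (b k); exists (maxn n0 (4 * m).+1).
  by split; [lia|lia|apply: ng; exact: leq_maxl].
pose N := fix N k := if k is k'.+1 then sval (next k (N k')) else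
  sval (next 0%N 0%N).
exists N; split=> [[|k]|k|[|k]] /=; by case: (next _ _) => ? [].
Qed.

Section lacunary.
Variable N : nat -> nat.
Hypotheses (N_gt0 : forall k, (0 < N k)%N)
  (N4 : forall k, (4 * N k <= N k.+1)%N).

Lemma lacunary_le i j : (i <= j)%N -> (N i <= N j)%N.
Proof.
move/subnKC <-; elim: (j - i)%N => [|m IH]; first by rewrite addn0.
by rewrite addnS; have := N4 (i + m); lia.
Qed.

Lemma lacunary_lt i j : (i < j)%N -> (4 * N i <= N j)%N.
Proof. by move=> /lacunary_le; have := N4 i; lia. Qed.

Lemma lacunary_id k : (k <= N k)%N.
Proof. by elim: k => // k IH; have := N4 k; have := N_gt0 k; lia. Qed.

End lacunary.

(** * Functions constant on each member of a sequence of disjoint sets *)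

Section plateau.
Context (T : Type) (R : realType).
Implicit Types (S : nat -> set T) (c : nat -> R).

(** The index is picked by choice; disjointness of the [S k] is what makes the value independent of
    it. *)
Definition plateau S c (y : T) : R :=
  if pselect (exists k, S k y) is left e then c (projT1 (cid e)) else 0.

Lemma plateauE S c k y : trivIset setT S -> S k y -> plateau S c y = c k.
Proof.
move=> tS Sky; rewrite /plateau; case: pselect => [e|[]]; last by exists k.
case: cid => j /= Sjy; congr c; apply: tS => //; by exists y.
Qed.

Lemma plateau_out S c y : ~ (\bigcup_k S k) y -> plateau S c y = 0.
Proof. by rewrite /plateau; case: pselect => // -[k Sky] []; exists k. Qed.

Lemma plateau_ge0 S c y : (forall k, 0 <= c k) -> 0 <= plateau S c y.
Proof. by rewrite /plateau; case: pselect. Qed.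

(** Any index whose set contains [y] is at least [k], so its height is at most [c k]; elsewhere the
    value is 0. *)
Lemma plateau_le S c k y : (forall k, 0 <= c k) ->
  {homo c : i j / (i <= j)%N >-> j <= i} ->
  (forall j, (j < k)%N -> ~ S j y) -> plateau S c y <= c k.
Proof.
move=> c0 ndc nS; rewrite /plateau; case: pselect => // e.
by case: cid => j /= Sjy; apply: ndc; rewrite leqNgt; apply/negP => /nS.
Qed.

End plateau.

(** The dyadic bounds sum to 1; this normalizes the total mass of [f] in both settings. *)
Lemma nneseries_geo_le1 (R : realType) (u : nat -> \bar R) :
  (forall k, (0 <= u k)%E) -> (forall k, (u k <= (2 ^- k.+1)%:E)%E) ->
  (\sum_(k <oo) u k <= 1)%E.
Proof.
move=> u0 uk; apply: le_trans (_ : \sum_(k <oo) (1 / (2 ^ k.+1)%:R)%:E <= _)%E.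
  apply: lee_nneseries => // k _; rewrite div1r natrX; exact: uk.
by apply: le_trans (epsilon_trick0 _ _) _.
Qed.

Section plateau_integral.
Context d (T : measurableType d) (R : realType).
Variables (mu : {measure set T -> \bar R}) (S : nat -> set T) (c : nat -> R).
Hypotheses (mS : forall k, measurable (S k)) (tS : trivIset setT S)
  (c0 : forall k, 0 <= c k).

(** The function is constant on each of countably many measurable pieces and on the complement of
    their union. *)
Lemma measurable_plateau : measurable_fun setT (plateau S c).
Proof.
rewrite -(setUv (\bigcup_k S k)).
have mU : measurable (\bigcup_k S k) by exact: bigcup_measurable.
apply/measurable_funU => //; first exact: measurableC.
split; last first.
  apply: (eq_measurable_fun (cst (0 : R))) => [y|]; last exact: measurable_cst.
  by rewrite inE => Sx; rewrite plateau_out.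
apply/measurable_fun_bigcup => // k.
apply: (eq_measurable_fun (cst (c k))) => [y|]; last exact: measurable_cst.
by rewrite inE => Sx; rewrite (plateauE _ tS Sx).
Qed.

Lemma integral_plateau :
  (\int[mu]_x (plateau S c x)%:E = \sum_(k <oo) (c k)%:E * mu (S k))%E.
Proof.
have mp : measurable_fun setT (fun x => (plateau S c x)%:E).
  by apply/measurable_EFinP; exact: measurable_plateau.
transitivity (\int[mu]_(x in \bigcup_k S k) (plateau S c x)%:E)%E.
  rewrite [RHS]integral_mkcond; apply: eq_integral => x _.
  by rewrite patchE; case: ifPn => // /negP; rewrite inE => Sx; rewrite plateau_out.
rewrite ge0_integral_bigcup//.
- apply: eq_eseriesr => k _; rewrite -integral_cst//; apply: eq_integral => x.
  by rewrite inE => Sx; rewrite (plateauE _ tS Sx).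
- exact: measurable_funS mp.
- by move=> x _; rewrite lee_fin plateau_ge0.
Qed.

End plateau_integral.

Lemma esum_plateau (T : choiceType) (R : realType) (S : nat -> set T)
    (c : nat -> R) : trivIset setT S -> (forall k, 0 <= c k) ->
  (\esum_(x in setT) (plateau S c x)%:E =
   \sum_(k <oo) \esum_(x in S k) (c k)%:E)%E.
Proof.
move=> tS c0; transitivity (\esum_(x in \bigcup_k S k) (plateau S c x)%:E)%E.
  rewrite [RHS]esum_mkcond; apply: eq_esum => x _.
  by case: ifPn => // /negP; rewrite inE => Sx; rewrite plateau_out.
rewrite nneseries_sum_bigcup//; last by move=> x; rewrite lee_fin plateau_ge0.
apply: eq_eseriesr => k _; apply: eq_esum => x Sx.
by rewrite (plateauE _ tS Sx).
Qed.

Lemma dive_ge1 (R : realType) (x : \bar R) (r : R) :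
  0 < r -> (r%:E <= x)%E -> (1 <= x / r%:E)%E.
Proof. by move=> r0; rewrite inver gt_eqF// lee_pdivlMr// mul1e. Qed.

(** * The construction on the integers *)

Section discrete.
Context (R : realType).
Implicit Types (f : int -> R) (n a : int) (r m : nat).

(** The average of radius 0 is [|f n|] itself, so if it dominates all the others, the radius 0
    attains the supremum. *)
Lemma int_frequency_eq0 f n :
  (forall r, int_avg f r n <= `|f n|) -> int_frequency f n = 0%N.
Proof.
move=> Af; have A0 : int_avg f 0 n = `|f n|.
  by rewrite /int_avg big_ord1 subrr addr0 divr1.
have att : int_attaining_radii f n 0%N.
  rewrite /int_attaining_radii /= A0; apply/eqP; rewrite eq_le; apply/andP; split.
    by apply: ge_ereal_sup => _ [r _ <-]; rewrite lee_fin.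
  by apply: ereal_sup_ubound; exists 0%N => //; rewrite A0.
have /(@xgetPex _ 0%N) [_ /(_ _ att)] : exists r, int_attaining_radii f n r /\
    forall s, int_attaining_radii f n s -> (r <= s)%N by exists 0%N.
by rewrite leqn0 => /eqP.
Qed.

Lemma esum_int_interval f a m : (forall n, 0 <= f n) ->
  (\esum_(n in [set (a + i%:Z)%R | i in `I_m]) (f n)%:E =
   (\sum_(i < m) f (a + i%:Z))%:E)%E.
Proof.
move=> f0; rewrite esum_image; last first.
  by move=> i j _ _ /addrI[].
rewrite esum_fset//; last by move=> i _; rewrite lee_fin.
by rewrite fsumEFin// -fsbig_ord.
Qed.

Lemma int_avg_le_window f r n (c : R) :
  (forall i, (i <= 2 * r)%N -> `|f (n + (i%:Z - r%:Z))| <= c) ->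
  int_avg f r n <= c.
Proof.
move=> fc; rewrite /int_avg ler_pdivrMr// mulr_natr.
rewrite -[in leRHS](card_ord (2 * r).+1) -sumr_const.
by apply: ler_sum => i _; apply: fc; rewrite -ltnS.
Qed.

Lemma int_avg_le_mass f r n :
  (\esum_(x in [set: int]) `|(f x)%:E| <= 1)%E ->
  int_avg f r n <= ((2 * r).+1)%:R^-1.
Proof.
move=> f1; rewrite /int_avg ler_piMl// -lee_fin; apply: le_trans f1.
under eq_bigr do rewrite addrCA addrC.
rewrite -(@esum_int_interval (fun x => `|f x|))//.
by rewrite [leLHS]esum_mkcond; apply: le_esum => x _; case: ifP.
Qed.

Lemma counting_ge (T : choiceType) (X : set T) m :
  (`I_m #<= X)%card -> (m%:R%:E <= counting X :> \bar R)%E.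
Proof.
move=> mX; rewrite /counting; case: asboolP => [finX|_]; last exact: leey.
by rewrite lee_fin ler_nat; exact: leq_card_fset_set.
Qed.

Lemma exists_int_frequency0 (g : nat -> R) : (forall N, 0 < g N) ->
  g N @[N --> \oo] --> +oo ->
  exists f : int -> R,
    [/\ summable [set: int] (EFin \o f), f <> (fun=> 0) &
     (1 <= limn_esup (fun N : nat =>
       counting (int_Zset f N) / (N%:R / g N)%:E))%E].
Proof.
move=> g_gt0 goo.
(* Choosing the scales for the minimum makes both [g (N k)] and [N k] large; the latter absorbs the
   rounding of the block lengths. *)
have moo : Num.min (g N) N%:R @[N --> \oo] --> +oo.
  apply/cvgryPge => M; near=> N; rewrite le_min; apply/andP; split.
    by near: N; move: M; exact/cvgryPge.
  by near: N; exact: nbhs_infty_ger.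
have [N [N_gt0 N4 gN]] := exists_lacunary (fun k => 8 * 2 ^+ k.+1) moo.
have gN1 k : 8 * 2 ^+ k.+1 <= g (N k).
  by apply: le_trans (gN k) _; rewrite ge_min lexx.
have gN2 k : 8 * 2 ^+ k.+1 <= (N k)%:R :> R.
  by apply: le_trans (gN k) _; rewrite ge_min lexx orbT.
have NR k : 0 < (N k)%:R :> R by rewrite ltr0n.
(* Block length: the successor of the truncation is still at least [N k / g (N k)], so no loss
   occurs in the limsup. *)
pose m k := (Num.truncn ((N k)%:R / g (N k))).+1.
have m_ge k : (N k)%:R / g (N k) <= (m k)%:R.
  have /truncn_itv/andP[_ /ltW//] : 0 <= (N k)%:R / g (N k).
  by rewrite divr_ge0 ?ltW.
have m_le k : (m k)%:R <= (N k)%:R / g (N k) + 1.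
  have /truncn_itv/andP[] : 0 <= (N k)%:R / g (N k) by rewrite divr_ge0 ?ltW.
  by rewrite /m -natr1 lerD2r.
(* A window of radius at least [N k / 4] has more than [N k / 2] points, so mass 1 bounds its
   average by this height. *)
pose c k : R := 2 / (N k)%:R.
have c_ge0 k : 0 <= c k by rewrite divr_ge0.
have cm k : c k * (m k)%:R <= 2 ^- k.+1.
  apply: le_trans (_ : 2 / g (N k) + 2 / (N k)%:R <= _).
    apply: le_trans (ler_wpM2l (c_ge0 k) (m_le k)) _.
    rewrite le_eqVlt; apply/orP; left; apply/eqP.
    by rewrite /c; field; rewrite !gt_eqF.
  have p0 : 0 < 2 ^+ k.+1 :> R by exact: exprn_gt0.
  have p8 : 0 < 8 * 2 ^+ k.+1 :> R by rewrite mulr_gt0.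
  have : (g (N k))^-1 <= (8 * 2 ^+ k.+1)^-1 by rewrite lef_pV2 ?posrE.
  have : (N k)%:R^-1 <= (8 * 2 ^+ k.+1)^-1 :> R by rewrite lef_pV2 ?posrE.
  have : 0 < 2 ^- k.+1 :> R by rewrite invr_gt0.
  by rewrite invfM; lra.
(* Here the constant 8 gives [g (N k) >= 16] and [N k >= 16], whence
   [8 * m k <= N k / 2 + 8 <= N k]. *)
have m8 k : (8 * m k <= N k)%N.
  have p2 : 2 <= 2 ^+ k.+1 :> R by rewrite exprS ler_peMr// exprn_ege1// ler1n.
  rewrite -(ler_nat R) natrM; have := gN2 k.
  have : (N k)%:R / g (N k) <= (N k)%:R / 16.
    by rewrite ler_pM2l// lef_pV2 ?posrE//; have := gN1 k; lra.
  by have := m_le k; lra.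
(* The last [m k] integers below [N k]; by [m8] they all lie in the upper half of the range from 0
   to [N k]. *)
pose S k := [set (N k - m k)%N%:Z + i%:Z | i in `I_(m k)].
have SP k n : S k n -> exists x : nat,
    [/\ n = x%:Z, (x < N k)%N & (N k <= 2 * x)%N].
  move=> [i /= im <-]; exists (N k - m k + i)%N; rewrite PoszD.
  by have := m8 k; split=> //; lia.
have tS : trivIset [set: nat] S.
  have lt_disj i j : (i < j)%N -> ~ (S i `&` S j !=set0).
    move=> /(lacunary_lt N4) Nij [_ [/SP[x [-> xi _]] /SP[y [[<-] _ xj]]]].
    by have := N_gt0 j; lia.
  move=> i j _ _ Sij; have [/lt_disj|/lt_disj|//] := ltngtP i j.
    by move/(_ Sij).
  by rewrite setIC => /(_ Sij).
have c_nd : {homo c : i j / (i <= j)%N >-> j <= i}.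
  move=> i j /(lacunary_le N4) Nij.
  by rewrite /c ler_pM2l// lef_pV2 ?posrE// ler_nat.
pose f := plateau S c.
have f_ge0 n : 0 <= f n by exact: plateau_ge0.
have mass : (\esum_(x in [set: int]) `|(f x)%:E| <= 1)%E.
  under eq_esum do rewrite gee0_abs ?lee_fin//.
  rewrite esum_plateau//; apply: nneseries_geo_le1 => k.
    by apply: esum_ge0 => x _; rewrite lee_fin.
  rewrite (@esum_int_interval (fun=> c k))//.
  by rewrite lee_fin sumr_const card_ord -(mulr_natr (c k)); exact: cm.
have freq k n : S k n -> int_frequency f n = 0%N.
  move=> Skn; have fn : f n = c k by exact: plateauE.
  apply: int_frequency_eq0 => r; rewrite ger0_norm// fn.
  (* A window of radius below [N k / 4] around a point that is at least [N k / 2] stays above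
     [N k / 4], hence above every earlier block. Larger windows are handled by the total mass. *)
  have [rN|Nr] := ltnP (4 * r) (N k).
    apply: int_avg_le_window => i ir; rewrite ger0_norm//.
    apply: plateau_le => // j /(lacunary_lt N4) Njk /SP[y [ny yj _]].
    by have [x [nx _ kx]] := SP _ _ Skn; lia.
  apply: le_trans (int_avg_le_mass r n mass) _.
  rewrite /c -[leRHS]invrK invf_div lef_pV2 ?posrE ?divr_gt0//.
  by rewrite ler_pdivrMr// -natrM ler_nat; lia.
exists f; split.
- by rewrite /summable; apply: le_lt_trans mass _; exact: ltry.
- move=> f0; have S0 : S 0%N (N 0%N - m 0%N)%N%:Z.
    by exists 0%N => //=; rewrite addr0.
  have : f (N 0%N - m 0%N)%N%:Z = c 0%N by exact: plateauE.
  by rewrite f0 => /eqP; rewrite eq_sym gt_eqF// divr_gt0.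
- apply: (limn_esup_ge (lacunary_id N_gt0 N4)) => k.
  have Ng0 : 0 < (N k)%:R / g (N k) by rewrite divr_gt0.
  apply: dive_ge1 => //; apply: le_trans (_ : (m k)%:R%:E <= _)%E.
    by rewrite lee_fin.
  apply: counting_ge; apply: card_le_trans (_ : S k #<= _)%card.
    have : (S k #= `I_(m k))%card.
      by apply: inj_card_eq => i j _ _ /addrI[].
    by rewrite card_eq_le => /andP[].
  apply: subset_card_le => n Skn; split; last exact: freq Skn.
  by have [x [-> xN _]] := SP _ _ Skn; lia.
Unshelve. all: by end_near. Qed.

End discrete.

(* The integral of a nonnegative function is a supremum over the simple functions
   below it, so it is monotone without measurability assumptions; in particular
   Zset need not be shown measurable. *)
Lemma le_ge0_integral d (T : measurableType d) (R : realType)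
    (mu : {measure set T -> \bar R}) (D : set T) (f g : T -> \bar R) :
  (forall x, D x -> (0 <= f x)%E) -> (forall x, D x -> (f x <= g x)%E) ->
  (\int[mu]_(x in D) f x <= \int[mu]_(x in D) g x)%E.
Proof.
move=> f0 fg; have g0 x : D x -> (0 <= g x)%E.
  by move=> Dx; apply: le_trans (f0 _ Dx) (fg _ Dx).
rewrite !ge0_integralE//; apply: le_ereal_sup => _ [h /= hf <-].
exists h => //= x; apply: le_trans (hf x) _.
by rewrite !patchE; case: ifPn => //; rewrite inE => /fg.
Qed.

(** Holds for arbitrary sets, by induction on the dimension: the product measure is defined as the
    integral of the measures of the sections, and both levels are monotone. *)
Lemma lebesgue_tuple_le (R : realType) d (A B : set (euclidean R d)) :
  A `<=` B -> (lebesgue_tuple R d A <= lebesgue_tuple R d B)%E.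
Proof.
elim: d A B => [|d IH] A B AB.
  rewrite /= !diracE lee_fin ler_nat; case: (boolP (_ \in A)) => //.
  by rewrite inE => /AB; rewrite -in_setE => ->.
rewrite /= /lebesgue_step /pushforward /=.
apply: le_ge0_integral => [x _|x _ /=]; first exact: measure_ge0.
by apply: IH => y; rewrite /xsection /= !inE => /AB.
Qed.

(** * Measures of boxes and Euclidean balls *)

Section boxes.
Context (R : realType) (d : nat).
Local Notation mu := (lebesgue_tuple R d).
Implicit Types (a b : 'I_d -> R) (x y : euclidean R d).

Definition box a b : set (euclidean R d) :=
  [set x | forall i, a i < tnth x i < b i].

Lemma boxE a b : box a b =
  [set x | forall i, [set` `]a i, b i[] (tnth x i : measurableTypeR R)].
Proof. by apply/seteqP; split => x xab i /=; have := xab i; rewrite /= in_itv. Qed.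

Lemma measurable_box a b : measurable (box a b).
Proof.
rewrite (_ : box a b = \big[setI/setT]_(i < d)
    ((fun x : euclidean R d => tnth x i) @^-1` [set` `]a i, b i[])).
  apply: bigsetI_measurable => i _; rewrite -[X in measurable X]setTI.
  by apply: measurable_tnth => //; exact: measurable_itv.
rewrite boxE -classical_sets.bigcap_seq; apply/seteqP; split => x xab /= i.
  by move=> _; exact: xab.
by apply: xab; rewrite /= mem_index_enum.
Qed.

Lemma lebesgue_box a b : (forall i, a i <= b i) ->
  mu (box a b) = (\prod_(i < d) (b i - a i))%:E.
Proof.
move=> ab; rewrite boxE.
rewrite (@lebesgue_tuple_box R d (fun i => [set` `]a i, b i[])); last first.
  by move=> i; exact: measurable_itv.
rewrite -prodEFin; apply: eq_bigr => i _.
rewrite lebesgue_measure_itv/= lte_fin; case: ltP => // ba.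
by rewrite (le_anti (_ : a i <= b i <= a i)) ?subrr// ab.
Qed.

End boxes.

Section balls.
Context (R : realType) (d : nat).
Local Notation mu := (lebesgue_tuple R d).
Implicit Types (x y : euclidean R d) (r s : R).

(* Unqualified, edist is the extended distance of the analysis library. *)
Lemma edist_coord x y i : `|(tnth x i : R) - (tnth y i : R)| <= Defs.edist x y.
Proof.
rewrite /Defs.edist -sqrtr_sqr ler_wsqrtr// (bigD1 i)//= lerDl.
by apply: sumr_ge0 => j _; exact: sqr_ge0.
Qed.

(** The crude factor [d], in place of its square root, keeps all later constants rational. *)
Lemma edist_le x y s :
  (forall i, `|(tnth x i : R) - (tnth y i : R)| <= s) -> Defs.edist x y <= d%:R * s.
Proof.
move=> xys; have [d0|d_gt0] := posnP d.
  rewrite /Defs.edist big1 ?sqrtr0 => [|i _]; first by rewrite d0 mul0r.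
  by exfalso; have := ltn_ord i; rewrite [X in (_ < X)%N]d0.
have s0 : 0 <= s by apply: le_trans (xys (Ordinal d_gt0)).
have ds0 : 0 <= d%:R * s by rewrite mulr_ge0.
rewrite -[leRHS](ger0_norm ds0) -sqrtr_sqr ler_wsqrtr//.
apply: le_trans (_ : \sum_(i < d) s ^+ 2 <= _).
  by apply: ler_sum => i _; rewrite -real_normK ?num_real// lerXn2r ?nnegrE.
rewrite sumr_const card_ord -[s ^+ 2 *+ d]mulr_natl exprMn ler_wpM2r ?sqr_ge0//.
by rewrite expr2 ler_peMl// ler1n.
Qed.

Lemma measurable_eball x r : measurable (eball x r).
Proof.
rewrite -[eball x r]setTI.
have : measurable_fun setT (Defs.edist x).
  have msqrt : measurable_fun setT (@Num.sqrt R).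
    by apply: continuous_measurable_fun; exact: sqrt_continuous.
  apply: (measurableT_comp msqrt).
  apply: measurable_sum => i; apply: measurable_funX; apply: measurable_funB => //.
  exact: measurable_tnth.
move/(_ measurableT _ (measurable_itv `]-oo, r[)).
by congr (measurable (_ `&` _)); apply/seteqP; split => y /=; rewrite in_itv.
Qed.

(** The ball lies in the cube of side [2 * r] with the same centre. *)
Lemma lebesgue_eball_le x r : 0 <= r -> (mu (eball x r) <= ((2 * r) ^+ d)%:E)%E.
Proof.
move=> r0; pose a i := (tnth x i : R) - r; pose b i := (tnth x i : R) + r.
have ab i : a i <= b i by rewrite /a /b; lra.
apply: (@le_trans _ _ (mu (box a b))).
  apply: lebesgue_tuple_le => y xy i; rewrite /a /b.
  by have := le_lt_trans (edist_coord x y i) xy; rewrite ltr_norml; lra.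
rewrite lebesgue_box// lee_fin (eq_bigr (fun=> 2 * r)); last first.
  by move=> i _; rewrite /a /b; ring.
by rewrite prodr_const card_ord.
Qed.

(** The concentric cube of side [r / d] lies in the ball: by [edist_le] its points are within
    [r / 2] of the centre. *)
Lemma lebesgue_eball_ge x r : 0 < r -> (((r / d%:R) ^+ d)%:E <= mu (eball x r))%E.
Proof.
move=> r0; pose s := r / (2 * d%:R).
have s0 : 0 <= s by rewrite divr_ge0 ?mulr_ge0 ?(ltW r0).
pose a i := (tnth x i : R) - s; pose b i := (tnth x i : R) + s.
have ab i : a i <= b i by rewrite /a /b; lra.
apply: (@le_trans _ _ (mu (box a b))).
  rewrite lebesgue_box// lee_fin (eq_bigr (fun=> r / d%:R)); last first.
    by move=> i _; rewrite /a /b /s invfM mulrCA; lra.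
  by rewrite prodr_const card_ord.
apply: lebesgue_tuple_le => y yab; rewrite /eball /=.
apply: (@le_lt_trans _ _ (d%:R * s)).
  by apply: edist_le => i; have := yab i; rewrite /a /b ler_norml; lra.
have [d0|d_gt0] := posnP d; first by rewrite d0 mul0r.
have -> : d%:R * s = r / 2 by rewrite /s; field; rewrite pnatr_eq0 -lt0n.
by lra.
Qed.

Lemma lebesgue_eball_fin x r : (0 < d)%N -> 0 < r ->
  exists2 v, 0 < v & mu (eball x r) = v%:E.
Proof.
move=> d_gt0 r0; have := lebesgue_eball_ge x r0.
have := lebesgue_eball_le x (ltW r0); case: (mu _) => [v|//|//] _.
rewrite lee_fin => rv; exists v => //; apply: lt_le_trans rv.
by rewrite exprn_gt0// divr_gt0// ltr0n.
Qed.

Lemma box_interior (a b : 'I_d -> R) x : box a b x ->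
  exists2 r, 0 < r & eball x r `<=` box a b.
Proof.
move=> xab; pose e i := Num.min ((tnth x i : R) - a i) (b i - (tnth x i : R)).
(* The least distance to a face, capped at 1, the seed of the iterated minimum. *)
exists (\big[Num.min/1]_i e i) => [|y xy i].
  apply: lt_bigmin => // i _; rewrite lt_min.
  by have := xab i; lra.
have : `|(tnth x i : R) - (tnth y i : R)| < e i.
  apply: le_lt_trans (edist_coord x y i) _; apply: lt_le_trans xy _.
  exact: bigmin_le_cond.
by rewrite lt_min !ltr_norml; lra.
Qed.

End balls.

(** * The construction on Euclidean space *)

Section continuous.
Context (R : realType) (d : nat).
Hypothesis d_gt0 : (0 < d)%N.
Local Notation mu := (lebesgue_tuple R d).
Implicit Types (f : euclidean R d -> R) (x : euclidean R d) (r c : R).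

Lemma ball_avg_le f x r c : 0 < r ->
  (\int[mu]_(y in eball x r) `|(f y)%:E| <= c%:E * mu (eball x r))%E ->
  (ball_avg f r x <= c%:E)%E.
Proof.
move=> r0; rewrite /ball_avg.
have [v v0 ->] := lebesgue_eball_fin x d_gt0 r0.
by move=> fcv; rewrite inver gt_eqF// muleC lee_pdivrMr.
Qed.

Lemma ball_avg_le_ball f x r c : 0 < r ->
  (forall y, eball x r y -> `|f y| <= c) -> (ball_avg f r x <= c%:E)%E.
Proof.
move=> r0 fc; apply: ball_avg_le => //.
rewrite -integral_cst; last exact: measurable_eball.
by apply: le_ge0_integral => y yx; rewrite ?abse_ge0// lee_fin fc.
Qed.

Lemma ball_avg_eq_cst f x r c : 0 < r ->
  (forall y, eball x r y -> `|f y| = c) -> ball_avg f r x = c%:E.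
Proof.
move=> r0 fc; rewrite /ball_avg (eq_integral (cst c%:E)); last first.
  by move=> y; rewrite inE => /fc <-.
have [v v0 muv] := lebesgue_eball_fin x d_gt0 r0.
rewrite integral_cst; last exact: measurable_eball.
transitivity (v%:E^-1 * (c%:E * v%:E))%E; first by rewrite -muv.
by rewrite inver gt_eqF// -!EFinM mulrCA mulVf ?mulr1// gt_eqF.
Qed.

(** By [lebesgue_eball_ge] the hypothesis says that [c] times the measure of the ball is at least 1,
    which bounds the integral. *)
Lemma ball_avg_le_mass f x r c : 0 < r ->
  (\int[mu]_y `|(f y)%:E| <= 1)%E -> 1 <= c * (r / d%:R) ^+ d ->
  (ball_avg f r x <= c%:E)%E.
Proof.
move=> r0 f1 cr; apply: ball_avg_le => //.
have rd0 : 0 < (r / d%:R) ^+ d by rewrite exprn_gt0// divr_gt0// ltr0n.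
have c0 : 0 <= c by rewrite -(pmulr_lge0 _ rd0) (le_trans _ cr).
apply: (@le_trans _ _ 1%E).
  apply: le_trans f1; rewrite [leLHS]integral_mkcond.
  by apply: le_ge0_integral => y _; rewrite patchE; case: ifP => // _;
    rewrite abse_ge0.
apply: (@le_trans _ _ (c%:E * ((r / d%:R) ^+ d)%:E)%E).
  by rewrite -EFinM lee_fin.
by rewrite lee_wpmul2l ?lee_fin// lebesgue_eball_ge.
Qed.

(** All radii up to [s] give the average [c], the largest possible, so the attaining radii
    accumulate at 0 and their infimum is 0. *)
Lemma frequency_eq0 f x c : (exists2 s, 0 < s &
    forall y, eball x s y -> `|f y| = c) ->
  (forall r, 0 < r -> (ball_avg f r x <= c%:E)%E) -> frequency f x = 0.
Proof.
move=> [s s0 fs] fc.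
have small r : 0 < r -> r <= s -> ball_avg f r x = c%:E.
  move=> r0 rs; apply: ball_avg_eq_cst => // y xy; apply: fs.
  exact: lt_le_trans xy rs.
have maxE : maximal f x = c%:E.
  apply/eqP; rewrite eq_le; apply/andP; split.
    by apply: ge_ereal_sup => _ [r r0 <-]; exact: fc.
  by apply: ereal_sup_ubound; exists s; rewrite ?small.
have att r : 0 < r -> r <= s -> attaining_radii f x r.
  by move=> r0 rs; split => //; rewrite maxE small.
(* The branch with no attaining radius returns 0 by definition. *)
rewrite /frequency; case: ifPn => // _.
have lb0 : lbound (attaining_radii f x) 0 by move=> r [/ltW].
apply/eqP; rewrite eq_le; apply/andP; split; last first.
  by apply: lb_le_inf => //; exists s; exact: att.
apply/ler_addgt0Pl => e e0; rewrite addr0.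
apply: (@le_trans _ _ (Num.min e s)); last by rewrite ge_min lexx.
apply: ge_inf; first by exists 0.
by apply: att; rewrite ?lt_min ?e0// ge_min lexx orbT.
Qed.

Lemma exists_frequency0 (g : nat -> R) : (forall N, 0 < g N) ->
  g N @[N --> \oo] --> +oo ->
  exists f : euclidean R d -> R,
    [/\ mu.-integrable [set: _] (EFin \o f),
        ~ {ae mu, forall x, f x = 0} &
        (1 <= limn_esup (fun N : nat =>
          mu (Zset f N) / (N%:R ^+ d / g N)%:E))%E].
Proof.
move=> g_gt0 goo; pose D : R := d%:R; pose K : R := (4 * D ^+ 2) ^+ d.
have D1 : 1 <= D by rewrite ler1n.
have D0 : 0 < D by rewrite ltr0n.
have D2 : 0 < D ^+ 2 by rewrite exprn_gt0.
have K0 : 0 < K by rewrite exprn_gt0// mulr_gt0.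
have [N [N_gt0 N4 gN]] := exists_lacunary (fun k => K * 2 ^+ k.+1) goo.
have NR k : 0 < (N k)%:R :> R by rewrite ltr0n.
have ND k : 0 < (N k)%:R / D by rewrite divr_gt0.
pose i0 := Ordinal d_gt0.
(* Width in the coordinate [i0]: the other [d - 1] sides equal [N k / D], so the volume is
   [N k ^+ d / g (N k)]. *)
pose w k := D ^+ d.-1 * (N k)%:R / g (N k).
have w0 k : 0 < w k by rewrite divr_gt0// mulr_gt0// exprn_gt0.
have DK : D ^+ d <= K.
  rewrite /K lerXn2r ?nnegrE ?(ltW D0)//; first by rewrite mulr_ge0 ?ltW.
  by rewrite expr2; nra.
have g2 k : 2 * D ^+ d <= g (N k).
  have p2 : 2 <= 2 ^+ k.+1 :> R by rewrite exprS ler_peMr// exprn_ege1// ler1n.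
  by apply: le_trans (gN k); rewrite [leRHS]mulrC ler_pM ?exprn_ge0 ?(ltW D0).
have w_le k : w k <= (N k)%:R / (2 * D).
  rewrite /w ler_pdivrMr// mulrAC ler_pdivlMr ?mulr_gt0//.
  have -> : D ^+ d.-1 * (N k)%:R * (2 * D) = (N k)%:R * (2 * D ^+ d).
    by rewrite -[in RHS](prednK d_gt0) exprS; ring.
  by rewrite ler_pM2l.
(* All coordinates lie between 0 and [N k / D], so the norm is at most [N k]; the coordinate [i0]
   exceeds [N k / (2 * D)], which separates the box from earlier ones. *)
pose a k (i : 'I_d) : R := if i == i0 then (N k)%:R / (2 * D) else 0.
pose b k (i : 'I_d) : R :=
  if i == i0 then (N k)%:R / (2 * D) + w k else (N k)%:R / D.
have halfN k : (N k)%:R / (2 * D) = (N k)%:R / D / 2 :> R.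
  by rewrite invfM mulrA mulrAC.
pose S k := box (a k) (b k).
have mS k : measurable (S k) by exact: measurable_box.
have muS k : mu (S k) = ((N k)%:R ^+ d / g (N k))%:E.
  rewrite lebesgue_box => [|i]; last first.
    by rewrite /a /b; case: ifP => _; [rewrite lerDl|]; exact: ltW.
  rewrite (bigD1 i0)//= (eq_bigr (fun=> (N k)%:R / D)) => [|i /negPf i_n0].
    rewrite prodr_const cardC1 card_ord /a /b eqxx addrAC subrr add0r.
    congr EFin; rewrite /w expr_div_n -[in RHS](prednK d_gt0) exprS.
    by field; rewrite !gt_eqF// exprn_gt0.
  by rewrite /a /b i_n0 subr0.
have Spos k x i : S k x -> 0 < (tnth x i : R) <= (N k)%:R / D.
  move=> /(_ i); rewrite /a /b; case: ifP => _; have := w_le k;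
    rewrite halfN; have := ND k; lra.
have Sfst k x : S k x -> (N k)%:R / D / 2 < (tnth x i0 : R).
  by move=> /(_ i0); rewrite /a eqxx halfN => /andP[].
have Nlt i j : (i < j)%N -> (N i)%:R / D <= (N j)%:R / D / 4.
  move=> /(lacunary_lt N4); rewrite -(ler_nat R) natrM => Nij.
  by rewrite mulrAC ler_pM2r ?invr_gt0//; lra.
have tS : trivIset [set: nat] S.
  have lt_disj i j : (i < j)%N -> ~ (S i `&` S j !=set0).
    move=> /Nlt Nij [x [/(Spos _ _ i0) Six /Sfst Sjx]].
    by have := ND j; lra.
  move=> i j _ _ Sij; have [/lt_disj|/lt_disj|//] := ltngtP i j.
    by move/(_ Sij).
  by rewrite setIC => /(_ Sij).
pose c k : R := K / (N k)%:R ^+ d.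
have c_ge0 k : 0 <= c k by rewrite ltW// divr_gt0// exprn_gt0.
have c_nd : {homo c : i j / (i <= j)%N >-> j <= i}.
  move=> i j /(lacunary_le N4) Nij.
  rewrite /c ler_pM2l// lef_pV2 ?posrE ?exprn_gt0//.
  by rewrite lerXn2r ?nnegrE// ler_nat.
pose f := plateau S c.
have f_ge0 x : 0 <= f x by exact: plateau_ge0.
have mf : measurable_fun setT f by exact: measurable_plateau.
have mass : (\int[mu]_x `|(f x)%:E| <= 1)%E.
  under eq_integral do rewrite gee0_abs ?lee_fin//.
  rewrite integral_plateau//; apply: nneseries_geo_le1 => k.
    by rewrite mule_ge0// lee_fin.
  apply: (@le_trans _ _ ((c k)%:E * ((N k)%:R ^+ d / g (N k))%:E)%E).
    by rewrite -muS.
  (* The mass on the box is [K / g (N k)], and the scales were chosen with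
     [g (N k) >= K * 2 ^+ k.+1]. *)
  rewrite -EFinM lee_fin /c mulrA divfK ?gt_eqF ?exprn_gt0//.
  rewrite ler_pdivrMr// -ler_pdivrMl ?invr_gt0 ?exprn_gt0//.
  by rewrite invrK mulrC.
have freq k x : S k x -> frequency f x = 0.
  move=> Skx; have fS y : S k y -> `|f y| = c k.
    by move=> Sky; rewrite ger0_norm// /f (plateauE _ tS Sky).
  apply: (@frequency_eq0 _ _ (c k)) => [|r r0].
    have [s s0 xs] := box_interior Skx; exists s => // y /xs; exact: fS.
  (* In a ball of radius at most [N k / (4 * D)] the coordinate [i0] stays above [N k / (4 * D)],
     which bounds that coordinate on all earlier boxes. *)
  have [rN|Nr] := leP r ((N k)%:R / D / 4).
    apply: ball_avg_le_ball => // y xy; rewrite ger0_norm//.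
    apply: plateau_le => // j /Nlt Njk /(Spos _ _ i0) Sjy.
    have := le_lt_trans (edist_coord x y i0) xy; rewrite ltr_norml.
    by have := Sfst _ _ Skx; lra.
  apply: ball_avg_le_mass => //.
  rewrite /c /K -expr_div_n -exprMn exprn_ege1//.
  rewrite mulrA ler_pdivlMr// mul1r mulrAC ler_pdivlMr//.
  move: Nr; rewrite ltr_pdivrMr// ltr_pdivrMr//.
  by move=> Nr; nra.
exists f; split.
- apply/integrableP; split; first exact/measurable_EFinP.
  by apply: le_lt_trans mass _; exact: ltry.
(* A null set containing the points where [f] is nonzero would contain [S 0], which has positive
   measure. *)
- move=> [A [mA A0 fA]].
  have : (mu (S 0%N) <= mu A)%E.
    apply: lebesgue_tuple_le => x S0x; apply: fA => /= fx.
    have : f x = c 0%N by exact: plateauE.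
    by rewrite fx => /eqP; rewrite eq_sym gt_eqF// divr_gt0// exprn_gt0.
  by rewrite A0 muS lee_fin leNgt divr_gt0// exprn_gt0.
- apply: (limn_esup_ge (lacunary_id N_gt0 N4)) => k.
  apply: dive_ge1; first by rewrite divr_gt0// exprn_gt0.
  rewrite -muS; apply: lebesgue_tuple_le => x Skx; split; last exact: freq Skx.
  apply: (@le_trans _ _ (d%:R * ((N k)%:R / D))).
    apply: edist_le => i; rewrite tnth_nseq subr0 gtr0_norm.
      by have /andP[] := Spos _ _ i Skx.
    by have /andP[] := Spos _ _ i Skx.
  by rewrite mulrC divfK// gt_eqF.
Qed.

(** The unit ball fits in a cube of side 2, so a limsup of at least 1 suffices for the stated
    bound. *)
Lemma unit_ball_ratio_le1 :
  (mu (eball (eorigin R d) 1) / (2 ^+ d)%:E <= 1)%E.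
Proof.
have p0 : 0 < 2 ^+ d :> R by exact: exprn_gt0.
rewrite inver gt_eqF// lee_pdivrMr// mul1e.
by have := lebesgue_eball_le (eorigin R d) ler01; rewrite mulr1.
Qed.

End continuous.

Theorem theorem2p7 (R : realType) (g : nat -> R)
    (g_gt0 : forall N, 0 < g N)
    (g_nd : nondecreasing_seq g)
    (g_oo : g N @[N --> \oo] --> +oo) :
  (forall d : nat, (0 < d)%N ->
     exists f : euclidean R d -> R,
       [/\ (lebesgue_tuple R d).-integrable [set: _] (EFin \o f),
           ~ {ae lebesgue_tuple R d, forall x, f x = 0} &
           (lebesgue_tuple R d (eball (eorigin R d) 1) / (2 ^+ d)%:E <=
            limn_esup (fun N : nat =>
              lebesgue_tuple R d (Zset f N) / (N%:R ^+ d / g N)%:E))%E])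
  /\
  (exists f : int -> R,
     [/\ summable [set: int] (EFin \o f),
         f <> (fun=> 0) &
         (1 <= limn_esup (fun N : nat =>
            counting (int_Zset f N) / (N%:R / g N)%:E))%E]).
Proof.
split=> [d d_gt0|]; last exact: exists_int_frequency0.
have [f [fint f_neq0 Zf]] := exists_frequency0 d_gt0 g_gt0 g_oo.
by exists f; split => //; apply: le_trans (unit_ball_ratio_le1 R d) Zf.
Qed.
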